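(* Let $1\le p\le\infty$ and let $X$ be the vector space over $\mathbb{K}$ ($\mathbb{K}=\mathbb{R}$ or $\mathbb{C}$) of all sequences $(x_n)_{n\in\mathbb{Z}}$ of scalars with finite support, endowed with the $\ell_p$-norm. Let $T:X\to X$ be given by $$T((x_n)_{n\in\mathbb{Z}}):=(w_{n+1}x_{n+1})_{n\in\mathbb{Z}},$$ where $w_n:=1/2$ if $n\le0$ and $w_n:=2$ if $n\ge1$. Then $T$ is an invertible generalized hyperbolic operator on $X$ (with continuous inverse), $T$ does not have the periodic shadowing property (hence it does not have the strict periodic shadowing property), and $T$ is chain recurrent (i.e. $\mathrm{CR}(T)=X$) but not Devaney chaotic.
   Context: $\mathbb{N}_0=\{0,1,2,\dots\}$. Generalized hyperbolic (for an invertible operator $T$ with continuous inverse on a normed space $X$): there are subspaces $M,N$ such that $X=M\oplus N$ is a topological direct sum (i.e. an algebraic direct sum for which $(y,z)\mapsto y+z$ is a homeomorphism $M\times N\to X$), $T(M)\subset M$, $T^{-1}(N)\subset N$, and there exist $c>0$, $t\in(0,1)$ with $\|T^ny\|\le c\,t^n\|y\|$ and $\|T^{-n}z\|\le c\,t^n\|z\|$ for all $y\in M$, $z\in N$, $n\in\mathbb{N}_0$. For a neighborhood $U$ of $0$, a $U$-chain from $x_0$ to $x_k$ is a finite sequence $(x_j)_{j=0}^k$ ($k\ge1$) with $Tx_j-x_{j+1}\in U$ for $0\le j<k$; a $U$-pseudotrajectory $(x_j)_{j\in\mathbb{N}_0}$ satisfies this for all $j$. $T$ has the periodic shadowing property if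 for every neighborhood $V$ of $0$ there is a neighborhood $U$ of $0$ such that for every periodic $U$-pseudotrajectory $(x_j)_{j\in\mathbb{N}_0}$ there is a periodic point $x$ of $T$ with $x_j-T^jx\in V$ for all $j\in\mathbb{N}_0$; the strict version additionally requires that $x$ can be chosen with $T^kx=x$ if $(x_j)$ has period $k$. $\mathrm{CR}(T)$ is the set of all $x\in X$ such that for every neighborhood $U$ of $0$ there is a $U$-chain for $T$ from $x$ to itself. $T$ is topologically transitive if for all nonempty open $A,B\subset X$ there is $n\in\mathbb{N}_0$ with $T^n(A)\cap B\ne\emptyset$; $T$ is Devaney chaotic if it is topologically transitive and its set of periodic points is dense in $X$. *)

(* Defs.v *)
From HB Require Import structures.
From mathcomp Require Import all_boot all_order all_algebra finmap.
From mathcomp Require Import all_classical all_reals all_analysis.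
From mathcomp Require Import complex.

Set Implicit Arguments.
Unset Strict Implicit.
Unset Printing Implicit Defensive.

Import Order.TTheory GRing.Theory Num.Theory.
Import numFieldNormedType.Exports.

Local Open Scope classical_set_scope.
Local Open Scope ring_scope.

(* f maps A, with the subspace topology, homeomorphically onto Z; the inverse g
   of the restriction of f to A is regarded as a map into the ambient space. *)
Definition homeomorphism_on (Y Z : topologicalType) (A : set Y) (f : Y -> Z) :=
  [/\ set_bij A setT f, {within A, continuous f} &
      exists g : Z -> Y, [/\ continuous g, forall z, A (g z) & cancel g f]].

Section dynamics.
Context (K : numFieldType) (X : normedModType K).
Implicit Types (T S : X -> X) (M N U V : set X) (x : nat -> X).

Definition continuous_inverse T S :=
  [/\ cancel T S, cancel S T & continuous S].

Definition invertible_operator T :=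
  [/\ linear T, continuous T & exists S, continuous_inverse T S].

Definition topological_direct_sum M N :=
  [/\ submod_closed [in M], submod_closed [in N],
      (forall v, exists y z, [/\ M y, N z & v = y + z]),
      M `&` N = [set 0] &
      homeomorphism_on (M `*` N) (fun q : X * X => q.1 + q.2)].

(* K may be the field of complex numbers, with its partial order: the conditions
   0 < c and 0 < t < 1 then say in particular that c and t are real. *)
Definition generalized_hyperbolic T :=
  exists S M N,
    [/\ continuous_inverse T S, topological_direct_sum M N,
        T @` M `<=` M, S @` N `<=` N &
        exists c t : K, [/\ 0 < c, 0 < t < 1,
          forall y n, M y -> `|iter n T y| <= c * t ^+ n * `|y| &
          forall z n, N z -> `|iter n S z| <= c * t ^+ n * `|z|]].

(* Only the values of x at 0, ..., k matter. *)
Definition chain_from_to T U (a b : X) :=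
  exists k x, [/\ (0 < k)%N, x 0 = a, x k = b &
    forall j, (j < k)%N -> U (T (x j) - x j.+1)].

Definition pseudotrajectory T U x := forall j, U (T (x j) - x j.+1).

Definition has_period x (k : nat) := (0 < k)%N /\ forall j, x (j + k)%N = x j.

Definition periodic_point T (a : X) :=
  exists2 k, (0 < k)%N & iter k T a = a.

Definition periodic_shadowing T :=
  forall V, nbhs (0 : X) V -> exists2 U, nbhs (0 : X) U &
    forall x, pseudotrajectory T U x -> (exists k, has_period x k) ->
      exists2 a, periodic_point T a & forall j, V (x j - iter j T a).

Definition strict_periodic_shadowing T :=
  forall V, nbhs (0 : X) V -> exists2 U, nbhs (0 : X) U &
    forall x k, pseudotrajectory T U x -> has_period x k ->
      exists2 a, iter k T a = a & forall j, V (x j - iter j T a).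

Definition chain_recurrent_set T : set X :=
  [set a | forall U, nbhs (0 : X) U -> chain_from_to T U a a].

Definition topologically_transitive T :=
  forall A B : set X, open A -> open B -> A !=set0 -> B !=set0 ->
    exists n, (iter n T @` A) `&` B !=set0.

Definition devaney_chaotic T :=
  topologically_transitive T /\ dense [set a | periodic_point T a].

End dynamics.

Variant scalar_kind := real_scalars | complex_scalars.

Section scalars.
Context (R : realType).

Definition scalars (k : scalar_kind) : numFieldType :=
  match k with real_scalars => R | complex_scalars => R[i] end.

Definition modulus k : scalars k -> R :=
  match k with
  | real_scalars => fun a => `|a|
  | complex_scalars => fun a => ComplexField.Normc.normc a
  end.

(* Norms of normed modules over K take their values in K, so that the l_p-norm
   of a sequence of scalars has to be viewed as an element of K. *)
Definition of_real k : R -> scalars k :=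
  match k with
  | real_scalars => fun r => r
  | complex_scalars => fun r => (r%:C)%C
  end.

Context (k : scalar_kind).
Implicit Types a b : scalars k.

Lemma of_real_modulus a : of_real k (modulus a) = `|a|.
Proof. by case: k a. Qed.

Lemma of_realD (r s : R) : of_real k (r + s) = of_real k r + of_real k s.
Proof. by case: k => //=; rewrite rmorphD. Qed.

Lemma of_realM (r s : R) : of_real k (r * s) = of_real k r * of_real k s.
Proof. by case: k => //=; rewrite rmorphM. Qed.

Lemma of_real_inj : injective (of_real k).
Proof. by case: k => //= r s []. Qed.

Lemma of_real0 : of_real k 0 = 0.
Proof. by case: k. Qed.

Lemma ler_of_real (r s : R) : (of_real k r <= of_real k s) = (r <= s).
Proof. by case: k => //=; rewrite lecR. Qed.

Lemma modulus_ge0 a : 0 <= modulus a.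
Proof. by rewrite -ler_of_real of_real_modulus of_real0. Qed.

Lemma modulusD a b : modulus (a + b) <= modulus a + modulus b.
Proof. by rewrite -ler_of_real of_realD !of_real_modulus ler_normD. Qed.

Lemma modulusM a b : modulus (a * b) = modulus a * modulus b.
Proof. by apply: of_real_inj; rewrite of_realM !of_real_modulus normrM. Qed.

Lemma modulus_eq0 a : modulus a = 0 -> a = 0.
Proof.
by move=> /(congr1 (of_real k)); rewrite of_real_modulus of_real0 => /normr0_eq0.
Qed.

Lemma modulus0 : modulus (0 : scalars k) = 0.
Proof. by apply: of_real_inj; rewrite of_real_modulus of_real0 normr0. Qed.

End scalars.

Section lp_norm.
Context (R : realType).
Implicit Types (p : \bar R) (a b c : int -> R).

(* The value at p = -oo is irrelevant: only 1 <= p is considered below. *)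
Definition lp_norm p a : R :=
  match p with
  | r%:E => (\sum_(n \in [set: int]) `|a n| `^ r) `^ r^-1
  | +oo%E => sup [set `|a n| | n in [set: int]]
  | -oo%E => 0
  end.

Definition fin_supp (V : nmodType) (f : int -> V) :=
  finite_set [set n | f n != 0].

Lemma finite_minkowski (I : eqType) (s : seq I) (r : R) (f g : I -> R) :
  1 <= r -> (forall i, 0 <= f i) -> (forall i, 0 <= g i) ->
  (\sum_(i <- s) (f i + g i) `^ r) `^ r^-1 <=
  (\sum_(i <- s) f i `^ r) `^ r^-1 + (\sum_(i <- s) g i `^ r) `^ r^-1.
Proof.
move=> r1 f0 g0; have r0 : 0 < r by rewrite (lt_le_trans _ r1).
have rn0 : r != 0 by rewrite gt_eqF.
have powK x : 0 <= x -> (x `^ r^-1) `^ r = x.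
  by move=> x0; rewrite -powRrM mulVf// powRr1.
have powK' x : 0 <= x -> (x `^ r) `^ r^-1 = x.
  by move=> x0; rewrite -powRrM mulfV// powRr1.
have S0 h : 0 <= \sum_(i <- s) h i `^ r.
  by apply: sumr_ge0 => i _; rewrite powR_ge0.
have z h : (forall i, 0 <= h i) -> (\sum_(i <- s) h i `^ r) `^ r^-1 = 0 ->
    forall i, i \in s -> h i = 0.
  move=> h0 /eqP; rewrite powR_eq0 => /andP[hs _] i si.
  move: hs; rewrite psumr_eq0; last by move=> j _; rewrite powR_ge0.
  by move=> /allP/(_ i si)/=; rewrite powR_eq0 => /andP[/eqP].
set A := (\sum_(i <- s) f i `^ r) `^ r^-1.
set B := (\sum_(i <- s) g i `^ r) `^ r^-1.
have [A0|An0] := eqVneq A 0.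
  rewrite A0 add0r /B (@eq_big_seq _ _ _ _ s _ (fun i => g i `^ r))//.
  by move=> i si; rewrite (z f)// add0r.
have [B0|Bn0] := eqVneq B 0.
  rewrite B0 addr0 /A (@eq_big_seq _ _ _ _ s _ (fun i => f i `^ r))//.
  by move=> i si; rewrite (z g)// addr0.
have Agt0 : 0 < A by rewrite lt0r An0 powR_ge0.
have Bgt0 : 0 < B by rewrite lt0r Bn0 powR_ge0.
have Ar : A `^ r = \sum_(i <- s) f i `^ r by exact: powK (S0 f).
have Br : B `^ r = \sum_(i <- s) g i `^ r by exact: powK (S0 g).
have Ar0 : A `^ r != 0 by rewrite gt_eqF// powR_gt0.
have Br0 : B `^ r != 0 by rewrite gt_eqF// powR_gt0.
clearbody A B.
have ABgt0 : 0 < A + B by rewrite addr_gt0.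
suff: (\sum_(i <- s) (f i + g i) `^ r) `^ r^-1 <= ((A + B) `^ r) `^ r^-1.
  by rewrite powK'// ltW.
have ri0 : 0 <= r^-1 by rewrite invr_ge0 ltW.
apply: (ge0_ler_powR ri0); rewrite ?nnegrE ?powR_ge0 ?S0//.
pose t := A / (A + B).
have t0 : 0 <= t by rewrite divr_ge0 ?ltW.
have t1 : t <= 1 by rewrite ler_pdivrMr// mul1r lerDl ltW.
have onemt : 1 - t = B / (A + B).
  by rewrite /t -[X in X - _](@mulfV _ (A + B)) ?gt_eqF// -mulrBl addrAC subrr add0r.
have key i : (f i + g i) `^ r <=
    (A + B) `^ r * (t * (f i `^ r / A `^ r) + (1 - t) * (g i `^ r / B `^ r)).
  have -> : f i + g i = (A + B) * (t * (f i / A) + (1 - t) * (g i / B)).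
    have E u v : u != 0 -> (A + B) * (u / (A + B) * (v / u)) = v.
      move=> u0; have ABn0 : A + B != 0 by rewrite gt_eqF.
      by rewrite -mulrA mulrCA (mulVKf ABn0) mulrC divfK.
    by rewrite onemt /t mulrDr !E.
  have fA0 : 0 <= f i / A by rewrite divr_ge0// ltW.
  have gB0 : 0 <= g i / B by rewrite divr_ge0// ltW.
  have C0 : 0 <= t * (f i / A) + (1 - t) * (g i / B).
    by apply: addr_ge0; apply: mulr_ge0; rewrite ?subr_ge0.
  rewrite (powRM _ (ltW ABgt0) C0) ler_pM2l ?powR_gt0//.
  have := @convex_powR R r r1 (Itv01 t0 t1) (f i / A) (g i / B).
  rewrite !inE/= !in_itv/= !andbT => /(_ fA0 gB0).
  rewrite !convRE/= /unstable.onem.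
  have VE x : 0 < x -> x^-1 `^ r = (x `^ r)^-1.
    by move=> x0; rewrite -(powR_inv1 (ltW x0)) -powRrM mulN1r powRN.
  have iA0 : 0 <= A^-1 by rewrite invr_ge0 ltW.
  have iB0 : 0 <= B^-1 by rewrite invr_ge0 ltW.
  by rewrite (powRM _ (f0 i) iA0) (powRM _ (g0 i) iB0) (VE A)// (VE B).
apply: (le_trans (ler_sum _ (fun i _ => key i))).
rewrite -mulr_sumr big_split/= -!mulr_sumr -!mulr_suml -Ar -Br.
by rewrite !mulfV// !mulr1 addrC subrK mulr1.
Qed.

Lemma lp_norm_fset (A : {fset int}) (r : R) a : r != 0 ->
  (forall n, n \notin A -> a n = 0) ->
  lp_norm r%:E a = (\sum_(n <- A) `|a n| `^ r) `^ r^-1.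
Proof.
by move=> r0 aA; rewrite /= (fsbigTE A)// => n /aA ->; rewrite normr0 powR0.
Qed.

Lemma fin_suppP (V : nmodType) (f : int -> V) : fin_supp f ->
  exists A : {fset int}, forall n, n \notin A -> f n = 0.
Proof.
move=> ff; exists (fset_set [set n | f n != 0]) => n.
by rewrite in_fset_set// notin_setE/= => /negP/negPn/eqP.
Qed.

Lemma fin_supp_has_sup a : fin_supp a -> has_sup [set `|a n| | n in [set: int]].
Proof.
move=> /fin_suppP[A aA]; split; first by exists `|a 0|, 0.
exists (\sum_(n <- A) `|a n|) => _ [n _ <-].
have [nA|/aA ->] := boolP (n \in A); last by rewrite normr0 sumr_ge0.
by rewrite (big_fsetD1 n)//= lerDl sumr_ge0.
Qed.

Lemma lp_norm_triangle p a b c : (1 <= p)%E ->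
  fin_supp a -> fin_supp b -> (forall n, `|c n| <= `|a n| + `|b n|) ->
  lp_norm p c <= lp_norm p a + lp_norm p b.
Proof.
case: p => [r|_|//]; last first.
  move=> fa fb cab /=; apply: ge_sup; first by exists `|c 0|, 0.
  move=> _ [n _ <-]; apply: (le_trans (cab n)); apply: lerD.
    by apply: (sup_upper_bound (fin_supp_has_sup fa)); exists n.
  by apply: (sup_upper_bound (fin_supp_has_sup fb)); exists n.
rewrite lee_fin => r1 /fin_suppP[A aA] /fin_suppP[B bB] cab.
have r0 : 0 < r by rewrite (lt_le_trans _ r1).
have rn0 : r != 0 by rewrite gt_eqF.
have ri0 : 0 <= r^-1 by rewrite invr_ge0 ltW.
have aD n : n \notin (A `|` B)%fset -> a n = 0.
  by rewrite in_fsetU negb_or => /andP[/aA].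
have bD n : n \notin (A `|` B)%fset -> b n = 0.
  by rewrite in_fsetU negb_or => /andP[_ /bB].
have cD n : n \notin (A `|` B)%fset -> c n = 0.
  move=> nD; apply/eqP; rewrite -normr_le0; apply: (le_trans (cab n)).
  by rewrite (aD _ nD) (bD _ nD) normr0 addr0.
rewrite (lp_norm_fset rn0 aD) (lp_norm_fset rn0 bD) (lp_norm_fset rn0 cD).
have := @finite_minkowski _ (A `|` B)%fset r (fun n => `|a n|)
  (fun n => `|b n|) r1 (fun=> normr_ge0 _) (fun=> normr_ge0 _).
apply: le_trans.
have S0 (h : int -> R) : 0 <= \sum_(n <- (A `|` B)%fset) h n `^ r.
  by apply: sumr_ge0 => n _; rewrite powR_ge0.
apply: (ge0_ler_powR ri0); rewrite ?nnegrE ?S0//.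
apply: ler_sum => n _; apply: (ge0_ler_powR (ltW r0)); rewrite ?nnegrE//.
Qed.

Lemma lp_normZ_le p (s : R) a b : (1 <= p)%E -> fin_supp a -> 0 <= s ->
  (forall n, `|b n| = s * `|a n|) -> lp_norm p b <= s * lp_norm p a.
Proof.
case: p => [r|_|//]; last first.
  move=> fa s0 ba /=; apply: ge_sup; first by exists `|b 0|, 0.
  move=> _ [n _ <-]; rewrite ba; apply: ler_wpM2l => //.
  by apply: (sup_upper_bound (fin_supp_has_sup fa)); exists n.
rewrite lee_fin => r1 /fin_suppP[A aA] s0 ba.
have r0 : 0 < r by rewrite (lt_le_trans _ r1).
have rn0 : r != 0 by rewrite gt_eqF.
have bA n : n \notin A -> b n = 0.
  move=> nA; apply/eqP; rewrite -normr_le0 ba.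
  by rewrite (aA _ nA) normr0 mulr0.
rewrite (lp_norm_fset rn0 aA) (lp_norm_fset rn0 bA).
under eq_bigr do rewrite ba powRM//.
rewrite -mulr_sumr powRM ?powR_ge0//; last first.
  by apply: sumr_ge0 => n _; rewrite powR_ge0.
by rewrite -powRrM mulfV// powRr1.
Qed.

Lemma lp_norm_ge0 p a : 0 <= lp_norm p a.
Proof.
case: p => [r||//]; first exact: powR_ge0.
rewrite /=; have [supa|/sup_out->//] := pselect (has_sup [set `|a n| | n in [set: int]]).
by apply: (le_trans (normr_ge0 (a 0))); apply: sup_upper_bound => //; exists 0.
Qed.

Lemma lp_norm_eq0 p a : (1 <= p)%E -> fin_supp a -> lp_norm p a = 0 ->
  forall n, a n = 0.
Proof.
case: p => [r|_|//]; last first.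
  move=> fa /= a0 n; apply/eqP; rewrite -normr_le0 -a0.
  by apply: (sup_upper_bound (fin_supp_has_sup fa)); exists n.
rewrite lee_fin => r1 /fin_suppP[A aA].
have rn0 : r != 0 by rewrite gt_eqF// (lt_le_trans _ r1).
rewrite (lp_norm_fset rn0 aA) => /eqP; rewrite powR_eq0 => /andP[].
rewrite psumr_eq0; last by move=> j _; rewrite powR_ge0.
move=> /allP aA0 _ n; have [nA|/aA//] := boolP (n \in A).
by move: (aA0 n nA); rewrite /= powR_eq0 normr_eq0 => /andP[/eqP].
Qed.

End lp_norm.

Section c00.
Context (R : realType) (k : scalar_kind) (p : \bar R).

Definition finsupp_pred : {pred int -> scalars R k} :=
  fun f => `[< fin_supp f >].

Lemma finsupp_submod_closed : submod_closed finsupp_pred.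
Proof.
split; first by apply/asboolP; rewrite /fin_supp (_ : mkset _ = set0)//;
  apply/seteqP; split=> // n /=; rewrite eqxx.
move=> a f g /asboolP ff /asboolP fg; apply/asboolP.
have : finite_set ([set n | f n != 0] `|` [set n | g n != 0]).
  by rewrite finite_setU.
apply: sub_finite_set => n /= afg; apply: contrapT => /not_orP[].
move=> /negP/negPn/eqP f0 /negP/negPn/eqP g0; move/negP: afg; apply.
by rewrite -[X in X == _]/(a * f n + g n) f0 g0 mulr0 addr0.
Qed.

HB.instance Definition _ := GRing.isSubmodClosed.Build (scalars R k)
  (int -> scalars R k) finsupp_pred finsupp_submod_closed.

(* The exponent only matters for the norm put on the space. *)
Record c00 (p1 : (1 <= p)%E) := C00 {
  c00_seq :> int -> scalars R k;
  c00P : c00_seq \in finsupp_pred }.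

Context (p1 : (1 <= p)%E).
Implicit Types x y : c00 p1.

HB.instance Definition _ := [isSub for @c00_seq p1].
HB.instance Definition _ := [Choice of c00 p1 by <:].
HB.instance Definition _ := [SubChoice_isSubLmodule of c00 p1 by <:].

Definition c00_norm (x : c00 p1) : scalars R k :=
  of_real k (lp_norm p (fun n => modulus (x n))).

Lemma c00_fin_supp (x : c00 p1) : fin_supp x.
Proof. by apply/asboolP; exact: c00P. Qed.

Lemma modulus_fin_supp (x : c00 p1) : fin_supp (fun n => modulus (x n)).
Proof.
apply: sub_finite_set (c00_fin_supp x) => n /=.
by apply: contra_neq => ->; exact: modulus0.
Qed.

Let norm_modulus (a : scalars R k) : `|modulus a| = modulus a.
Proof. by rewrite ger0_norm// modulus_ge0. Qed.

Lemma c00DE x y n : (x + y) n = x n + y n.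
Proof. by []. Qed.

Lemma c00ZE (a : scalars R k) x n : (a *: x) n = a * x n.
Proof. by []. Qed.

Lemma c00_normD x y : c00_norm (x + y) <= c00_norm x + c00_norm y.
Proof.
rewrite /c00_norm -of_realD ler_of_real; apply: lp_norm_triangle => //;
  [exact: modulus_fin_supp..|move=> n].
by rewrite !norm_modulus c00DE modulusD.
Qed.

Let c00_normZ_le (a : scalars R k) x :
  c00_norm (a *: x) <= `|a| * c00_norm x.
Proof.
rewrite /c00_norm -of_real_modulus -of_realM ler_of_real; apply: lp_normZ_le => //;
  [exact: modulus_fin_supp|exact: modulus_ge0|move=> n].
by rewrite !norm_modulus c00ZE modulusM.
Qed.

Lemma c00_normZ (a : scalars R k) x : c00_norm (a *: x) = `|a| * c00_norm x.
Proof.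
apply: le_anti; rewrite c00_normZ_le/=.
have [->|a0] := eqVneq a 0.
  rewrite normr0 mul0r /c00_norm -(of_real0 R k) ler_of_real.
  exact: lp_norm_ge0.
have := c00_normZ_le a^-1 (a *: x).
by rewrite scalerA mulVf// scale1r normfV ler_pdivlMl ?normr_gt0.
Qed.

Lemma c00_norm_eq0 x : c00_norm x = 0 -> x = 0.
Proof.
rewrite /c00_norm -(of_real0 R k) => /of_real_inj.
move=> /(lp_norm_eq0 p1 (modulus_fin_supp x)) x0.
by apply: val_inj; apply/funext => n; exact: modulus_eq0 (x0 n).
Qed.

HB.instance Definition _ := Lmodule_isNormed.Build (scalars R k) (c00 p1)
  c00_normD c00_normZ c00_norm_eq0.

Lemma c00_normE x :
  `|x| = of_real k (lp_norm p (fun n => modulus (x n))).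
Proof. by []. Qed.

Lemma wshift_subproof (w : int -> scalars R k) (x : c00 p1) :
  (fun n => w (n + 1) * x (n + 1)) \in finsupp_pred.
Proof.
apply/asboolP; apply: (@sub_finite_set _ _
    ((fun n => n - 1) @` [set n | x n != 0])).
  move=> n /=; rewrite mulf_eq0 negb_or => /andP[_ xn].
  by exists (n + 1) => //; rewrite addrK.
by apply: finite_image; exact: c00_fin_supp.
Qed.

Definition weighted_shift (w : int -> scalars R k) (x : c00 p1) : c00 p1 :=
  C00 p1 (wshift_subproof w x).

Definition shift_weight (n : int) : scalars R k :=
  if n <= 0 then 2^-1 else 2.

End c00.

(* Main.v *)
Require Import Defs.
From HB Require Import structures.
From mathcomp Require Import all_boot all_order all_algebra finmap.
From mathcomp Require Import all_classical all_reals all_analysis.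
From mathcomp Require Import complex.
From mathcomp Require Import zify.

Set Implicit Arguments.
Unset Strict Implicit.
Unset Printing Implicit Defensive.

Import Order.TTheory GRing.Theory Num.Theory.
Import numFieldNormedType.Exports.

Local Open Scope classical_set_scope.
Local Open Scope ring_scope.

(** The shift contracts the sequences supported in n <= 0 and its inverse S
    contracts those supported in n > 0; as every finitely supported sequence is
    eventually moved into either subspace, T^m a -> 0 and S^m a -> 0 for every
    vector a. Hence 0 is the only periodic point, whereas
    S^m a, ..., S a, a, T a, ..., T^m a, 0 closes up to a periodic
    pseudotrajectory with arbitrarily small errors which passes through a. *)

(** * Iterates of inverse maps and at periodic points *)

Section iterates.
Context (A : Type).
Implicit Types T S : A -> A.

Lemma iter_cancel T S m : cancel S T -> cancel (iter m S) (iter m T).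
Proof. by move=> ST; elim: m => // m IH a; rewrite iterSr /= ST IH. Qed.

Lemma iter_fix_mul T k m a : iter k T a = a -> iter (m * k) T a = a.
Proof. by move=> Ta; elim: m => // m IH; rewrite mulSn iterD IH. Qed.

End iterates.

(** * Operators on a normed space whose forward and backward orbits tend to 0 *)

Section homoclinic.
Context (K : numFieldType) (X : normedModType K).
Implicit Types (T S P : X -> X) (M N : set X).

Lemma linear_norm_le_continuous T (s : K) : linear T -> 0 <= s ->
  (forall x, `|T x| <= s * `|x|) -> continuous T.
Proof.
move=> Tlin s0 Ts x; apply/cvgrPdist_lt => e e0.
(* [s] may vanish, so the estimate is divided by the larger constant [s + 1]. *)
have s10 : 0 < s + 1 by rewrite ltr_wpDl.
near=> y.
have -> : T x - T y = T (x - y).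
  by rewrite -scaleN1r addrC -Tlin scaleN1r addrC.
apply: le_lt_trans (Ts _) _; apply: (@le_lt_trans _ _ ((s + 1) * `|x - y|)).
  by rewrite ler_wpM2r// lerDl.
rewrite -ltr_pdivlMl//; near: y.
by apply: cvgr_dist_lt; [exact: cvg_id|rewrite mulr_gt0 ?invr_gt0].
Unshelve. all: by end_near. Qed.

(** The map [v |-> (P v, v - P v)] inverts addition on [M]*[N], so the homeomorphism reduces to the
    continuity of a single projection. *)
Lemma topological_direct_sum_proj P M N :
  submod_closed [in M] -> submod_closed [in N] -> continuous P ->
  (forall x, M (P x)) -> (forall x, N (x - P x)) ->
  (forall y z, M y -> N z -> P (y + z) = y) -> topological_direct_sum M N.
Proof.
move=> Ms Ns Pc PM PN PD.
have M0 : M 0 by have [+ _] := Ms; rewrite inE.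
have N0 : N 0 by have [+ _] := Ns; rewrite inE.
split=> //.
- by move=> v; exists (P v), (v - P v); rewrite addrCA subrr addr0.
- apply/seteqP; split=> [x [Mx Nx]|_ ->] //=.
  (* For [x] in both subspaces, [x = P (x + 0) = P (0 + x) = 0]. *)
  by rewrite -(PD x 0)// addr0 -[in LHS](add0r x) PD.
split.
- split=> [//|[y z] [y' z']|v _].
    rewrite !inE => -[/= My Nz] [/= My' Nz'] e.
    have yE : y = y' by rewrite -(PD _ _ My Nz) e PD.
    by move: e; rewrite yE => /addrI ->.
  exists (P v, v - P v); first by split; [exact: PM|exact: PN].
  by rewrite /= addrCA subrr addr0.
- apply: continuous_subspaceT => q.
  by apply: cvgD; [exact: cvg_fst|exact: cvg_snd].
- exists (fun v => (P v, v - P v)); split=> [v|v|v].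
  + by apply: cvg_pair; [exact: Pc|apply: cvgB; [exact: cvg_id|exact: Pc]].
  + by split; [exact: PM|exact: PN].
  + by rewrite /= addrCA subrr addr0.
Qed.

Lemma iter_contraction T M (t : K) m y : 0 <= t -> T @` M `<=` M ->
  (forall x, M x -> `|T x| <= t * `|x|) -> M y -> `|iter m T y| <= t ^+ m * `|y|.
Proof.
move=> t0 TM Tt; elim: m y => [|m IH] y My; first by rewrite mul1r.
rewrite iterSr exprSr -mulrA; apply: le_trans (IH _ (TM _ _)) _; first by exists y.
by rewrite ler_wpM2l ?exprn_ge0// Tt.
Qed.

Definition orbits_vanish T := forall a, iter m T a @[m --> \oo] --> (0 : X).

(** An orbit that has entered [M] stays there and decays geometrically. The convergence of [t ^+ m]
    is a hypothesis because [t < 1] does not imply it in a non-Archimedean field. *)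
Lemma orbits_vanish_contraction T M (t : K) :
  0 <= t -> t ^+ m @[m --> \oo] --> (0 : K^o) -> T @` M `<=` M ->
  (forall x, M x -> `|T x| <= t * `|x|) ->
  (forall a, exists l, M (iter l T a)) -> orbits_vanish T.
Proof.
move=> t0 tm TM Tt ev a; have [l Ml] := ev a.
suff : iter (m + l) T a @[m --> \oo] --> (0 : X) by rewrite cvg_shiftn.
(* Adding 1 keeps [C] positive even if the orbit has reached 0. *)
set C := `|iter l T a| + 1.
have C0 : 0 < C by rewrite ltr_wpDl.
apply/cvgr0Pnorm_lt => e e0.
have /cvgr0Pnorm_lt/(_ (e / C)) := tm; rewrite divr_gt0// => /(_ isT).
apply: filterS => m; rewrite ger0_norm ?exprn_ge0// ltr_pdivlMr// => tmC.
rewrite iterD (le_lt_trans (iter_contraction m t0 TM Tt Ml))//.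
by rewrite (le_lt_trans _ tmC)// ler_wpM2l ?exprn_ge0// lerDl.
Qed.

Lemma periodic_point_eq0 T a : orbits_vanish T -> periodic_point T a -> a = 0.
Proof.
move=> Tv [k k0 Ta]; apply: contrapT => /eqP a0.
have /cvgr0Pnorm_lt/(_ `|a|) := Tv a.
(* From time [m] on the orbit has norm below that of [a], but at time [m * k >= m] it is back at
   [a]. *)
rewrite normr_gt0 => /(_ a0) [m _ /(_ (m * k)%N)/=].
by rewrite leq_pmulr// iter_fix_mul// ltxx => /(_ isT).
Qed.

Lemma chain_recurrent_set_homoclinic T S : cancel S T ->
  orbits_vanish T -> orbits_vanish S -> chain_recurrent_set T = [set: X].
Proof.
move=> ST Tv Sv; apply/seteqP; split=> // a _ U U0.
(* The chain is [a, T a, ..., T^m a, S^m a, ..., S a, a]; its only error is the jump from [T^m a] to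
   [S^m a]. *)
have : (iter m.+1 T a - iter m S a) @[m --> \oo] --> (0 : X).
  rewrite -[0]subr0; apply: cvgB (Sv a).
  by have := Tv a; rewrite -cvg_shiftS.
move=> /(_ _ U0)[m _ /(_ m (leqnn m))/= Um].
exists (m + m).+1, (fun j => if (j <= m)%N then iter j T a else iter ((m + m).+1 - j) S a).
split=> //=; first by rewrite ltnNge leq_addr/= subnn.
move=> j; rewrite ltnS => jm.
have [jm'|mj] := ltnP j m.
  by rewrite (ltnW jm') subrr; exact: nbhs_singleton.
have [->|nmj] := eqVneq j m; first by rewrite leqnn subSS addnK.
have {nmj}mj : (m < j)%N by rewrite ltn_neqAle eq_sym nmj.
rewrite leqNgt mj/= subSS subSn// iterS ST subrr; exact: nbhs_singleton.
Qed.

(** A shadowing periodic point can only be 0, whereas the pseudotrajectory keeps returning to [a],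
    which lies outside the open ball of radius [|a|] around 0. *)
Lemma homoclinic_not_periodic_shadowing T S (a : X) : linear T -> cancel S T ->
  orbits_vanish T -> orbits_vanish S -> a != 0 -> ~ periodic_shadowing T.
Proof.
move=> Tlin ST Tv Sv a0 /(_ [set x | `|x| < `|a|]) [].
  by apply: nbhs0_lt; rewrite normr_gt0.
move=> U U0 shad.
have T0 : T 0 = 0 by have := Tlin (-1) 0 0; rewrite scaler0 addr0 scaleN1r addNr.
have TU : \forall m \near \oo, U (iter m.+1 T a).
  by have := Tv a; rewrite -cvg_shiftS => /(_ _ U0).
have SU : \forall m \near \oo, U (- iter m S a).
  have : - iter m S a @[m --> \oo] --> (0 : X).
    by rewrite -[0]oppr0; apply: cvgN; exact: Sv.
  by move=> /(_ _ U0).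
have [m _ /(_ m (leqnn m))[TUm SUm]] := filterI TU SU.
(* One period consists of the [2m + 1] points from [S^m a] to [T^m a], followed by 0; the vector [a]
   sits at index [m]. *)
set q := (m + m).+2.
pose x j := if (j %% q == (m + m).+1)%N then 0 else iter (j %% q) T (iter m S a).
have TSm i : iter (m + i) T (iter m S a) = iter i T a.
  by rewrite addnC iterD iter_cancel.
have [j||b perb /(_ m)] := shad x.
- have jq : (j %% q < q)%N by rewrite ltn_pmod.
  have jSq : (j.+1 %% q = (j %% q).+1 %% q)%N by rewrite -addn1 -modnDml addn1.
  rewrite /x jSq.
  (* Restarting from 0 costs [- S^m a], dropping from [T^m a] to 0 costs [T^(m+1) a], and every
     other step is exact. *)
  have [jE|jE] := eqVneq (j %% q)%N (m + m).+1.
    by rewrite jE modnn/= T0 sub0r.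
  have jq' : ((j %% q).+1 < q)%N by rewrite ltnS ltn_neqAle jE -ltnS.
  rewrite (modn_small jq') eqSS; case: eqP => [->|_].
    by rewrite subr0 -iterS -addnS TSm.
  by rewrite subrr; exact: nbhs_singleton.
- by exists q; split=> // j; rewrite /x modnDr.
- have -> : b = 0 by exact: periodic_point_eq0 perb.
  have -> : iter m T 0 = 0 by elim: m {TUm SUm q x TSm shad} => //= m ->.
  have mq : (m < (m + m).+1)%N by rewrite ltnS leq_addr.
  rewrite subr0 /x modn_small ?(ltn_trans mq)// ltn_eqF//=.
  by rewrite iter_cancel// ltxx.
Qed.

Lemma strict_periodic_shadowingW T :
  strict_periodic_shadowing T -> periodic_shadowing T.
Proof.
move=> sT V /sT[U U0 sU]; exists U => // x xU [k xk].
have [a ak ax] := sU x k xU xk; exists a => //; exists k => //; exact: xk.1.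
Qed.

(** Density of the periodic points fails: the ball around [a] of radius [|a|] misses 0, the only
    periodic point. *)
Lemma orbits_vanish_not_devaney T (a : X) :
  orbits_vanish T -> a != 0 -> ~ devaney_chaotic T.
Proof.
move=> Tv a0 [_ /(_ (ball a `|a|))]; case.
- by exists a; apply: ballxx; rewrite normr_gt0.
- exact: ball_open.
- move=> b [+ /(periodic_point_eq0 Tv) b0]; rewrite b0.
  by rewrite -ball_normE/= subr0 ltxx.
Qed.

End homoclinic.

(** * Translation invariance and monotonicity of the l_p-norm *)

Section lp_norm.
Context (R : realType).
Implicit Types (p : \bar R) (a b : int -> R).

Lemma lp_norm_shift p a d : lp_norm p (fun n => a (n + d)) = lp_norm p a.
Proof.
have dbij : bijective (fun n : int => n + d).
  by exists (fun n => n - d) => n; rewrite (addrK, subrK).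
case: p => [r||//] /=.
  by rewrite (reindex_fsbigT _ (fun n => `|a n| `^ r) dbij).
congr sup; apply/seteqP; split=> _ [n _ <-]; first by exists (n + d).
by exists (n - d) => //; rewrite subrK.
Qed.

(** [lp_normZ_le] demands an equality of moduli; the inequality comes from [lp_norm_triangle]
    applied to [s * a] and the zero sequence, whose norm vanishes by scaling with 0. *)
Lemma lp_norm_le_scale p (s : R) a b : (1 <= p)%E -> fin_supp a -> 0 <= s ->
  (forall n, `|b n| <= s * `|a n|) -> lp_norm p b <= s * lp_norm p a.
Proof.
move=> p1 fa s0 ba.
have fsa : fin_supp (fun n => s * a n).
  apply: sub_finite_set fa => n /=; apply: contra_neq => ->.
  by rewrite mulr0.
have f0 : fin_supp (fun _ : int => 0 : R).
  by apply: sub_finite_set (finite_set0 int) => n /=; rewrite eqxx.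
have n0 : lp_norm p (fun _ : int => 0 : R) <= 0.
  rewrite -[leRHS](mul0r (lp_norm p (fun=> 0))); apply: lp_normZ_le => // n.
  by rewrite normr0 mulr0.
apply: (@le_trans _ _ (lp_norm p (fun n => s * a n) + lp_norm p (fun=> 0))).
  apply: lp_norm_triangle => // n.
  by rewrite normr0 addr0 normrM (ger0_norm s0).
rewrite -[leRHS]addr0; apply: lerD => //.
by apply: lp_normZ_le => // n; rewrite normrM (ger0_norm s0).
Qed.

End lp_norm.

(** * Weighted translations of finitely supported sequences *)

Section weighted_translations.
Context (R : realType) (k : scalar_kind) (p : \bar R) (p1 : (1 <= p)%E).
Local Notation K := (scalars R k).
Implicit Types (w : int -> K) (x y : c00 k p1) (d n : int).

Lemma c00_ext x y : (forall n, x n = y n) -> x = y.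
Proof. by move=> xy; apply: val_inj; apply/funext. Qed.

Lemma wtranslate_subproof d w x :
  (fun n => w n * x (n + d)) \in @finsupp_pred R k.
Proof.
apply/asboolP; apply: (@sub_finite_set _ _
    ((fun n => n - d) @` [set n | x n != 0])).
  move=> n /=; rewrite mulf_eq0 negb_or => /andP[_ xn].
  by exists (n + d) => //; rewrite addrK.
by apply: finite_image; exact: c00_fin_supp.
Qed.

(** A common form of the shift ([d = 1]), its inverse ([d = -1]) and the projection of the splitting
    ([d = 0]). The weight is indexed by the target position. *)
Definition wtranslate d w x : c00 k p1 := C00 p1 (wtranslate_subproof d w x).

Lemma wtranslateE d w x n : wtranslate d w x n = w n * x (n + d).
Proof. by []. Qed.

Lemma wtranslate_linear d w : linear (wtranslate d w).
Proof.
move=> a x y; apply: c00_ext => n.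
by rewrite c00DE c00ZE !wtranslateE c00DE c00ZE mulrDr mulrCA.
Qed.

(** Bounding the weights only where [x] contributes lets this yield both continuity and the
    contraction on a subspace. *)
Lemma wtranslate_norm_le d w (s : K) x : 0 <= s ->
  (forall n, x (n + d) != 0 -> `|w n| <= s) -> `|wtranslate d w x| <= s * `|x|.
Proof.
move=> s0 ws; rewrite !c00_normE.
(* A nonnegative scalar is real even if [K] is complex, so the estimate can be moved to [R]. *)
have sE : s = of_real k (modulus s) by rewrite of_real_modulus ger0_norm.
rewrite {1}sE -of_realM ler_of_real.
rewrite -(lp_norm_shift p (fun n => modulus (x n)) d).
have norm_modulus (a : K) : `|modulus a| = modulus a.
  by rewrite ger0_norm// modulus_ge0.
apply: lp_norm_le_scale => //; last first.
  move=> n; rewrite !norm_modulus wtranslateE modulusM.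
  have [->|xn] := eqVneq (x (n + d)) 0; first by rewrite modulus0 !mulr0.
  by rewrite ler_wpM2r ?modulus_ge0// -(@ler_of_real R k) -sE of_real_modulus ws.
exact: modulus_ge0.
apply: (@sub_finite_set _ _
    ((fun n => n - d) @` [set n | x n != 0])).
  move=> n /= xn; exists (n + d); last by rewrite addrK.
  by apply: contra_neq xn => ->; exact: modulus0.
by apply: finite_image; exact: c00_fin_supp.
Qed.

Lemma wtranslate_continuous d w (s : K) : 0 <= s ->
  (forall n, `|w n| <= s) -> continuous (wtranslate d w).
Proof.
move=> s0 ws; apply: (linear_norm_le_continuous _ s0).
  exact: wtranslate_linear.
by move=> x; apply: wtranslate_norm_le.
Qed.

End weighted_translations.

(** * The shift with weights 1/2 and 2, and its hyperbolic splitting *)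

Section example.
Context (R : realType) (k : scalar_kind) (p : \bar R) (p1 : (1 <= p)%E).
Local Notation K := (scalars R k).
Local Notation X := (c00 k p1).
Local Notation w := (shift_weight R k).
Local Notation T := (weighted_shift w : X -> X).
Implicit Types (x y : X) (n : int).

Definition inverse_shift : X -> X := wtranslate (-1) (fun n => (w n)^-1).
Local Notation S := inverse_shift.

(** The splitting follows the change of weights: on [supp_le0] the shift meets only the weights 1/2,
    on [supp_gt0] its inverse meets only the reciprocals of 2. *)
Definition supp_le0 : set X := [set x | forall n, 0 < n -> x n = 0].
Definition supp_gt0 : set X := [set x | forall n, n <= 0 -> x n = 0].

Definition proj_le0 : X -> X := wtranslate 0 (fun n => (n <= 0)%R%:R).

Lemma weighted_shiftE : T = wtranslate 1 (fun n : int => w (n + 1)).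
Proof. by apply/funext => x; apply: c00_ext. Qed.

Lemma shift_weight_neq0 n : w n != 0.
Proof. by rewrite /shift_weight; case: ifP; rewrite ?invr_eq0 pnatr_eq0. Qed.

Lemma half_le2 : 2^-1 <= 2 :> K.
Proof. by rewrite (@le_trans _ _ 1)// ?invf_le1// ler1n. Qed.

Lemma shift_weight_le2 n : `|w n| <= 2.
Proof.
rewrite /shift_weight; case: ifP; rewrite ?normfV normr_nat// => _.
exact: half_le2.
Qed.

Lemma shift_weightV_le2 n : `|(w n)^-1| <= 2.
Proof.
rewrite /shift_weight; case: ifP => _; rewrite ?invrK ?normfV normr_nat//.
exact: half_le2.
Qed.

Lemma weighted_shift_linear : linear T.
Proof. by rewrite weighted_shiftE; exact: wtranslate_linear. Qed.

Lemma weighted_shift_continuous : continuous T.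
Proof.
rewrite weighted_shiftE; apply: (@wtranslate_continuous _ _ _ _ _ _ 2) => // n.
exact: shift_weight_le2.
Qed.

Lemma inverse_shift_continuous : continuous S.
Proof.
apply: (@wtranslate_continuous _ _ _ _ _ _ 2) => // n.
exact: shift_weightV_le2.
Qed.

Lemma weighted_shiftK : cancel T S.
Proof.
move=> x; apply: c00_ext => n.
by rewrite weighted_shiftE !wtranslateE subrK mulKf ?shift_weight_neq0.
Qed.

Lemma inverse_shiftK : cancel S T.
Proof.
move=> x; apply: c00_ext => n.
by rewrite weighted_shiftE !wtranslateE addrK mulVKf ?shift_weight_neq0.
Qed.

Lemma continuous_inverse_shift : continuous_inverse T S.
Proof.
split; [exact: weighted_shiftK|exact: inverse_shiftK|].
exact: inverse_shift_continuous.
Qed.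

Lemma weighted_shift_le0 : T @` supp_le0 `<=` supp_le0.
Proof.
move=> _ [x xM <-] n n0.
by rewrite weighted_shiftE wtranslateE xM ?mulr0// ltr_wpDr.
Qed.

Lemma inverse_shift_gt0 : S @` supp_gt0 `<=` supp_gt0.
Proof.
move=> _ [x xN <-] n n0.
by rewrite wtranslateE xN ?mulr0// (le_trans _ n0)// gerDl.
Qed.

Lemma weighted_shift_contract x : supp_le0 x -> `|T x| <= 2^-1 * `|x|.
Proof.
move=> xM; rewrite weighted_shiftE; apply: wtranslate_norm_le => // n.
have [n0|n0] := leP (n + 1) 0; last by rewrite xM// eqxx.
by rewrite /shift_weight n0 normfV normr_nat.
Qed.

Lemma inverse_shift_contract x : supp_gt0 x -> `|S x| <= 2^-1 * `|x|.
Proof.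
move=> xN; apply: wtranslate_norm_le => // n.
have [n0|n0] := leP (n - 1) 0; first by rewrite xN// eqxx.
by rewrite /shift_weight leNgt (lt_trans n0) ?gtrDl// normfV normr_nat.
Qed.

(** The geometric limit is taken in [R] and carried to the possibly complex field [K] along
    [of_real]. *)
Lemma cvg_half_expr : (2^-1 : K) ^+ m @[m --> \oo] --> (0 : K).
Proof.
apply/cvgr0Pnorm_lt => e e0.
have eE : e = of_real k (modulus e) by rewrite of_real_modulus gtr0_norm.
have ltr_of_real (r s : R) : (of_real k r < of_real k s) = (r < s).
  by rewrite !lt_neqAle ler_of_real (inj_eq (@of_real_inj R k)).
have hE m : `|(2^-1 : K) ^+ m| = of_real k ((2^-1 : R) ^+ m).
  rewrite normrX normfV normr_nat.
  elim: m => [|m IH]; first by rewrite !expr0; case: (k).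
  rewrite !exprS of_realM IH; congr (_ * _).
  by case: (k) => //=; rewrite fmorphV rmorph_nat.
have r0 : 0 < modulus e by rewrite -ltr_of_real -eE of_real0.
have : (2^-1 : R) ^+ m @[m --> \oo] --> (0 : R).
  by apply: cvg_expr; rewrite normfV normr_nat invf_lt1// ltr1n.
move=> /cvgr0Pnorm_lt/(_ _ r0); apply: filterS => m.
by move=> me; rewrite hE eE ltr_of_real (le_lt_trans (ler_norm _)).
Qed.

Lemma c00_bounded_supp x : exists l : nat, forall n, (l%:Z < `|n|) -> x n = 0.
Proof.
have /fin_suppP[A xA] := c00_fin_supp x.
(* The sum dominates each of its terms and thus serves as a bound for the support. *)
exists (\sum_(n <- A) `|n|)%N => n ln; apply: xA; apply: contraTN ln => nA.
by rewrite -leNgt -abszE lez_nat (big_fsetD1 n)//= leq_addr.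
Qed.

Lemma iter_weighted_shift_eq0 l x n : x (n + l%:Z) = 0 -> iter l T x n = 0.
Proof.
elim: l n => [|l IH] n; first by rewrite addr0.
by move=> xn; rewrite iterS weighted_shiftE wtranslateE -weighted_shiftE IH ?mulr0// -addrA -intS.
Qed.

Lemma iter_inverse_shift_eq0 l x n : x (n - l%:Z) = 0 -> iter l S x n = 0.
Proof.
elim: l n => [|l IH] n; first by rewrite subr0.
by move=> xn; rewrite iterS wtranslateE IH ?mulr0// -addrA -opprD -intS.
Qed.

(** The shift moves a finite support to the left until it lies in [n <= 0], where the contraction
    takes over. *)
Lemma weighted_shift_vanish : orbits_vanish T.
Proof.
apply: (@orbits_vanish_contraction _ _ _ supp_le0 2^-1) => //.
- exact: cvg_half_expr.
- exact: weighted_shift_le0.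
- exact: weighted_shift_contract.
move=> x; have [l xl] := c00_bounded_supp x; exists l => n n0.
apply: iter_weighted_shift_eq0; apply: xl.
by rewrite ger0_norm ?addr_ge0 ?(ltW n0)// ltrDr.
Qed.

Lemma inverse_shift_vanish : orbits_vanish S.
Proof.
apply: (@orbits_vanish_contraction _ _ _ supp_gt0 2^-1) => //.
- exact: cvg_half_expr.
- exact: inverse_shift_gt0.
- exact: inverse_shift_contract.
(* One step more than for the shift: at [n = 0] the source index must be [- l.+1] to leave the
   interval from [-l] to [l]. *)
move=> x; have [l xl] := c00_bounded_supp x; exists l.+1 => n n0.
apply: iter_inverse_shift_eq0; apply: xl.
rewrite -normrN opprB ger0_norm ?subr_ge0 ?(le_trans n0)//.
by rewrite intS -addrA addrCA ltrDl; lia.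
Qed.

Lemma supp_direct_sum : topological_direct_sum supp_le0 supp_gt0.
Proof.
apply: (@topological_direct_sum_proj _ _ proj_le0).
- split=> [|a x y]; first by rewrite inE.
  rewrite !inE => xM yM n n0; rewrite c00DE c00ZE xM// yM//.
  by rewrite mulr0 addr0.
- split=> [|a x y]; first by rewrite inE.
  rewrite !inE => xM yM n n0; rewrite c00DE c00ZE xM// yM//.
  by rewrite mulr0 addr0.
- apply: (@wtranslate_continuous _ _ _ _ _ _ 1) => // n.
  by case: (n <= 0); rewrite ?normr1 ?normr0.
- by move=> x n n0; rewrite wtranslateE leNgt n0 mul0r.
- move=> x n n0; rewrite -scaleN1r c00DE c00ZE wtranslateE n0 addr0.
  by rewrite mul1r mulN1r subrr.
- move=> y z yM zN; apply: c00_ext => n; rewrite wtranslateE addr0 c00DE.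
  have [n0|n0] := leP n 0; first by rewrite zN// addr0 mul1r.
  by rewrite yM// mul0r.
Qed.

Lemma weighted_shift_generalized_hyperbolic : generalized_hyperbolic T.
Proof.
exists S, supp_le0, supp_gt0; split.
- exact: continuous_inverse_shift.
- exact: supp_direct_sum.
- exact: weighted_shift_le0.
- exact: inverse_shift_gt0.
(* Each single step already contracts by 1/2, so the constant [c] is 1. *)
- exists 1, 2^-1; split=> //.
  + by rewrite invr_gt0 ltr0n invf_lt1// ltr1n.
  + move=> y n yM; rewrite mul1r; apply: iter_contraction yM => //.
      exact: weighted_shift_le0.
    exact: weighted_shift_contract.
  + move=> y n yN; rewrite mul1r; apply: iter_contraction yN => //.
      exact: inverse_shift_gt0.
    exact: inverse_shift_contract.
Qed.

Lemma c00_neq0 : exists x, x != 0.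
Proof.
have f0 : (fun n : int => (n == 0)%R%:R : K) \in @finsupp_pred R k.
  apply/asboolP; apply: sub_finite_set (finite_set1 (0 : int)) => n /=.
  by have [|_] := eqVneq n 0 => //; rewrite eqxx.
exists (C00 p1 f0); apply/eqP => /(congr1 (fun x : X => x 0))/eqP.
by rewrite [X in X == _]/(1 : K) oner_eq0.
Qed.

End example.

Theorem mainTheorem3 (R : realType) (k : scalar_kind) (p : \bar R)
    (p1 : (1 <= p)%E) :
  let T : c00 k p1 -> c00 k p1 := weighted_shift (shift_weight R k) in
  [/\ invertible_operator T /\ generalized_hyperbolic T,
      ~ periodic_shadowing T,
      ~ strict_periodic_shadowing T,
      chain_recurrent_set T = [set: c00 k p1] &
      ~ devaney_chaotic T].
Proof.
move=> T; have [a a0] := c00_neq0 k p1.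
have nps : ~ periodic_shadowing T.
  apply: homoclinic_not_periodic_shadowing a0.
  - exact: weighted_shift_linear.
  - exact: inverse_shiftK.
  - exact: weighted_shift_vanish.
  - exact: inverse_shift_vanish.
split=> //.
- split; last exact: weighted_shift_generalized_hyperbolic.
  split; [exact: weighted_shift_linear|exact: weighted_shift_continuous|].
  by exists (@inverse_shift R k p p1); exact: continuous_inverse_shift.
- by move=> /strict_periodic_shadowingW.
- apply: chain_recurrent_set_homoclinic.
  + exact: inverse_shiftK.
  + exact: weighted_shift_vanish.
  + exact: inverse_shift_vanish.
- by apply: orbits_vanish_not_devaney a0; exact: weighted_shift_vanish.
Qed.
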